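(* Let $k\ge 1$ and let $\{P_{n,\theta}:\theta\in\mathbb{R}^k\}$, $n=1,2,\ldots$, be a sequence of statistical experiments on measurable spaces $(\mathcal{X}_n,\mathfrak{X}_n)$ such that for every $\gamma\in\mathbb{R}^k$ the sequence $\{P_{n,\gamma/\sqrt n}\}_{n\ge1}$ is contiguous with respect to the sequence $\{P_{n,0}\}_{n\ge1}$. Let $\hat\theta_n$ be a sparse estimator sequence and let $C_n$ be a sequence of random sets in $\mathbb{R}^k$ based on $\hat\theta_n$. Assume that $C_n$ is a confidence set for $\theta$ with asymptotic infimal coverage probability $\delta$, i.e. $$\delta=\liminf_{n\to\infty}\inf_{\theta\in\mathbb{R}^k}P_{n,\theta}(\theta\in C_n).$$ Then for every $t\ge 0$ and every $e\in\mathbb{R}^k$ of (Euclidean) length $1$, $$\liminf_{n\to\infty}\sup_{\theta\in\mathbb{R}^k}P_{n,\theta}\left(\sqrt n\,\operatorname{ext}(C_n,\hat\theta_n,e)\ge t\right)\ge\delta .$$ In particular, for every $t\ge 0$, $$\liminf_{n\to\infty}\sup_{\theta\in\mathbb{R}^k}P_{n,\theta}\left(\sqrt n\,\operatorname{diam}(C_n)\ge t\right)\ge\delta .$$ (If the set inside the probability in either of the last two displays is not measurable, the probability is to be replaced by inner probability.)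
   Context: For each $n$, every $P_{n,\theta}$ is a probability measure on $(\mathcal{X}_n,\mathfrak{X}_n)$. Contiguity: a sequence $Q_n$ of probability measures is contiguous with respect to $P_n$ if for all measurable $E_n\in\mathfrak{X}_n$, $P_n(E_n)\to0$ implies $Q_n(E_n)\to0$. Estimator: $\hat\theta_n$ is a measurable function $\mathcal{X}_n\to\mathbb{R}^k$. The estimator sequence is sparse if for every $\theta\in\mathbb{R}^k$ and $i=1,\ldots,k$: $\lim_{n\to\infty}P_{n,\theta}(\hat\theta_{n,i}=0)=1$ whenever $\theta_i=0$, where $\hat\theta_{n,i}$ and $\theta_i$ are the $i$-th components of $\hat\theta_n$ and $\theta$. Random set: $C_n=C_n(\omega)$ is a subset of $\mathbb{R}^k$ for every $\omega\in\mathcal{X}_n$ such that for every $\theta\in\mathbb{R}^k$ the set $\{\omega\in\mathcal{X}_n:\theta\in C_n(\omega)\}$ belongs to $\mathfrak{X}_n$. The random set $C_n$ is based on the estimator $\hat\theta_n$ if $P_{n,\theta}(\hat\theta_n\in C_n)=1$ for every $\theta\in\mathbb{R}^k$ (inner probability if the event is not measurable). For $A\subseteq\mathbb{R}^k$, $\operatorname{diam}(A)=\sup\{\|x-y\|:x\in A,\,y\in A\}$ with $\|\cdot\|$ the Euclidean norm; for $a\in A$ and $e\in\mathbb{R}^k$ of length $1$, $\operatorname{ext}(A,a,e)=\sup\{\lambda\ge0:\lambda e+a\in A\}$. Both quantities may equal $+\infty$. *)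

(* Defs.v *)
From HB Require Import structures.
From mathcomp Require Import all_boot all_order all_algebra.
From mathcomp Require Import all_classical all_reals all_analysis.
Set Implicit Arguments.
Unset Strict Implicit.
Unset Printing Implicit Defensive.
Import Order.TTheory GRing.Theory Num.Theory.
Import numFieldTopology.Exports numFieldNormedType.Exports.
Local Open Scope classical_set_scope.
Local Open Scope ring_scope.

(* Vectors of R^k are row vectors 'rV[R]_k.  The library norm `|x| on them is
   the sup norm, hence a separate Euclidean norm. *)
Definition enorm (R : realType) (k : nat) (x : 'rV[R]_k) : R :=
  Num.sqrt (\sum_(i < k) x ord0 i ^+ 2).

(* R^k with its Borel sigma-algebra: the topology of 'rV[R]_k is the usual
   (product) one, which is also that of the Euclidean norm. *)
Definition borel_rV (R : realType) (k : nat) :=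
  g_sigma_algebraType (@open 'rV[R]_k).

(* Suprema in \bar R: the value +oo is possible, and sup of the empty set
   is -oo. *)
Definition diam (R : realType) (k : nat) (A : set 'rV[R]_k) : \bar R :=
  ereal_sup [set r | exists x y, [/\ A x, A y & r = (enorm (x - y))%:E]].

(* Meant for a \in A, in which case l = 0 is admissible. *)
Definition ext (R : realType) (k : nat) (A : set 'rV[R]_k) (a e : 'rV[R]_k) :
    \bar R :=
  ereal_sup [set r | exists l : R, [/\ 0 <= l, A (l *: e + a) & r = l%:E]].

Definition inner_probability (R : realType) (d : measure_display)
    (T : measurableType d) (P : probability T R) (A : set T) : \bar R :=
  ereal_sup [set P B | B in [set B | measurable B /\ B `<=` A]].

Lemma inner_probabilityE (R : realType) (d : measure_display)
    (T : measurableType d) (P : probability T R) (A : set T) :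
  measurable A -> inner_probability P A = P A.
Proof.
move=> mA; apply/eqP; rewrite eq_le; apply/andP; split.
  apply: ge_ereal_sup => _ [B [mB BA] <-].
  by apply: le_measure; rewrite ?inE.
by apply: ereal_sup_ubound; exists A => //; split.
Qed.

(* Sequences start at n = 1: the entry of index n : nat below stands for the
   experiment, estimator or set of sample size n.+1. *)

Definition contiguous (R : realType) (d : nat -> measure_display)
    (X : forall n, measurableType (d n))
    (Q P : forall n, probability (X n) R) : Prop :=
  forall E : forall n, set (X n),
    (forall n, measurable (E n)) ->
    (fun n => P n (E n)) @ \oo --> 0%E ->
    (fun n => Q n (E n)) @ \oo --> 0%E.

Definition estimator_sequence (R : realType) (k : nat)
    (d : nat -> measure_display) (X : forall n, measurableType (d n))
    (hat : forall n, X n -> 'rV[R]_k) : Prop :=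
  forall n, measurable_fun [set: X n] (hat n : X n -> borel_rV R k).

Definition sparse (R : realType) (k : nat) (d : nat -> measure_display)
    (X : forall n, measurableType (d n))
    (P : forall n, 'rV[R]_k -> probability (X n) R)
    (hat : forall n, X n -> 'rV[R]_k) : Prop :=
  forall (theta : 'rV[R]_k) (i : 'I_k), theta ord0 i = 0 ->
    (fun n => P n theta [set w | hat n w ord0 i = 0]) @ \oo --> 1%E.

Definition random_set (R : realType) (k : nat) (d : measure_display)
    (T : measurableType d) (C : T -> set 'rV[R]_k) : Prop :=
  forall theta : 'rV[R]_k, measurable [set w | C w theta].

Definition based_on (R : realType) (k : nat) (d : measure_display)
    (T : measurableType d) (P : 'rV[R]_k -> probability T R)
    (C : T -> set 'rV[R]_k) (hat : T -> 'rV[R]_k) : Prop :=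
  forall theta : 'rV[R]_k,
    inner_probability (P theta) [set w | C w (hat w)] = 1%E.

Definition asymptotic_infimal_coverage (R : realType) (k : nat)
    (d : nat -> measure_display) (X : forall n, measurableType (d n))
    (P : forall n, 'rV[R]_k -> probability (X n) R)
    (C : forall n, X n -> set 'rV[R]_k) : \bar R :=
  limn_einf (fun n =>
    ereal_inf [set P n theta [set w | C n w theta]
              | theta in [set: 'rV[R]_k]]).

(* Main.v *)
Require Import Defs.
From HB Require Import structures.
From mathcomp Require Import all_boot all_order all_algebra.
From mathcomp Require Import all_classical all_reals all_analysis.
Set Implicit Arguments.
Unset Strict Implicit.
Unset Printing Implicit Defensive.
Import Order.TTheory GRing.Theory Num.Theory.
Import numFieldTopology.Exports numFieldNormedType.Exports.
Local Open Scope classical_set_scope.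
Local Open Scope ring_scope.

(** At local parameters [theta_n = n^(-1/2) t e], a sparse estimator behaves as
    if the parameter were zero.  Sparsity at the single parameter [0], applied
    coordinate by coordinate with a union bound, gives
    [P_{n,0}(hat_n <> 0) -> 0] ([sparse_neq0_cvg0]), and contiguity transfers
    this to [P_{n,theta_n}(hat_n <> 0) -> 0].  Yet the confidence set has to
    cover [theta_n] with asymptotic probability at least [delta].  On the event
    that it covers [theta_n] while [hat_n = 0] belongs to it, the set contains
    two points at distance [n^(-1/2) t] in direction [e], so that both
    [sqrt n * ext] and [sqrt n * diam] are at least [t].

    [inf_coverage_le_sup_inner_probability] carries this out for any events
    implied by [0 \in C_n], [theta_n \in C_n] and [hat_n = 0] together.  Its
    quantitative core is, for each [n],
      [P(theta_n \in C_n) <= inner P(A_n) + P(hat_n <> 0)],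
    which comes from [le_inner_probability]: the event [hat_n \in C_n] has
    inner probability one and so costs nothing, although it need not be
    measurable. *)

Lemma limn_einf_le_near (R : realType) (u v : (\bar R)^nat) :
  (\forall n \near \oo, (u n <= v n)%E) -> (limn_einf u <= limn_einf v)%E.
Proof.
move=> [N _ uv]; rewrite !limn_einf_lim.
apply: lee_lim; [exact: is_cvg_einfs|exact: is_cvg_einfs|].
exists N => // m /= Nm; apply: le_ereal_inf_tmp => _ [n /= mn <-].
apply: ge_ereal_inf; exists (u n); first by exists n.
by apply: uv; exact: leq_trans mn.
Qed.

(** Eventually [r n < e], and a constant [e] can be pulled out of a lower
    limit. *)
Lemma limn_einf_le_add_cvg0 (R : realType) (u v r : (\bar R)^nat) :
  (forall n, (u n <= v n + r n)%E) -> r @ \oo --> 0%E ->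
  (limn_einf u <= limn_einf v)%E.
Proof.
move=> uvr r0; apply/lee_addgt0Pr => e e0.
rewrite addeC -limn_einf_shift//; apply: limn_einf_le_near.
have : \forall n \near \oo, (r n < e%:E)%E.
  by apply: (r0 [set x | x < e%:E]%E); apply: open_ereal_lt'; rewrite lte_fin.
apply: filterS => n rn; apply: (le_trans (uvr n)).
by rewrite addeC leeD2r// ltW.
Qed.

(** [S] has measurable subsets of probability above [1 - e]; intersecting [D]
    with one of them and removing [N] leaves a measurable subset of [A]. *)
Lemma le_inner_probability (R : realType) (d : measure_display)
    (T : measurableType d) (P : probability T R) (S D N A : set T) :
  inner_probability P S = 1%E -> measurable D -> measurable N ->
  (forall w, S w -> D w -> ~ N w -> A w) ->
  (P D <= inner_probability P A + P N)%E.
Proof.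
move=> S1 mD mN sub; apply/lee_addgt0Pr => e e0.
have [_ [B [mB BS] <-]] :
    exists2 x, [set P B | B in [set B | measurable B /\ B `<=` S]] x &
      (1 - e%:E < x)%E.
  have := @ub_ereal_sup_adherent R
    [set P B | B in [set B | measurable B /\ B `<=` S]] e e0.
  by rewrite -/(inner_probability P S) S1 => /(_ isT).
move=> PB.
have mDB : measurable ((D `&` B) `\` N).
  by apply: measurableD => //; exact: measurableI.
have mNB : measurable (N `|` ~` B).
  by apply: measurableU => //; exact: measurableC.
apply: (@le_trans _ _ (P (((D `&` B) `\` N) `|` (N `|` ~` B)))).
  apply: le_measure; rewrite ?inE//; first exact: measurableU.
  move=> w Dw; have [Nw|nNw] := pselect (N w); first by right; left.
  by have [Bw|nBw] := pselect (B w); [left; split|right; right].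
apply: (le_trans (measureU2 _ mDB mNB)); rewrite -addeA leeD//.
  apply: ereal_sup_ubound; exists ((D `&` B) `\` N) => //; split => //.
  by move=> w [[Dw Bw] nNw]; apply: sub => //; exact: BS.
apply: (le_trans (measureU2 _ mN (measurableC mB))); rewrite leeD2l//.
rewrite [leLHS](probability_setC P mB).
rewrite leeBlDr ?fin_num_measure//.
by rewrite addeC -leeBlDr// ltW.
Qed.

(** The complement of the hyperplane is open, hence a generator of the Borel
    sigma-algebra. *)
Lemma measurable_coord_eq0 (R : realType) (k : nat) (i : 'I_k) :
  measurable ([set x | x ord0 i = 0] : set (borel_rV R k)).
Proof.
rewrite -[X in measurable X]setCK; apply: measurableC.
apply: sub_sigma_algebra.
have -> : ~` [set x : 'rV[R]_k | x ord0 i = 0] =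
    (fun x : 'rV[R]_k => x ord0 i) @^-1` (~` [set 0]) by [].
apply: open_comp => [x _|]; first exact: coord_continuous.
exact/closed_openC/accessible_closed_set1/hausdorff_accessible/norm_hausdorff.
Qed.

Lemma measure_bigsetU_le (R : realType) (d : measure_display)
    (T : measurableType d) (mu : {measure set T -> \bar R}) (I : Type)
    (s : seq I) (F : I -> set T) :
  (forall i, measurable (F i)) ->
  (mu (\big[setU/set0]_(i <- s) F i) <= \sum_(i <- s) mu (F i))%E.
Proof.
move=> mF; elim: s => [|i s IH]; first by rewrite !big_nil measure0.
rewrite !big_cons; apply: (le_trans (measureU2 _ _ _)) => //.
  exact: bigsetU_measurable.
by rewrite leeD2l.
Qed.

Lemma neq0_bigsetU_coord (R : realType) (k : nat) (T : Type)
    (f : T -> 'rV[R]_k) :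
  [set w | f w <> 0] = \big[setU/set0]_(i < k) ~` [set w | f w ord0 i = 0].
Proof.
rewrite -bigcup_seq; apply/seteqP; split => w /=.
  apply: contra_notP => nf; apply/rowP => i; rewrite mxE.
  apply: contrapT => fi; apply: nf; exists i => //=.
  by rewrite mem_index_enum.
by move=> [i _ fi] f0; apply: fi; rewrite /= f0 mxE.
Qed.

Lemma enormZ (R : realType) (k : nat) (a : R) (x : 'rV[R]_k) :
  enorm (a *: x) = `|a| * enorm x.
Proof.
rewrite /enorm -sqrtr_sqr -sqrtrM ?sqr_ge0// mulr_sumr.
by congr Num.sqrt; apply: eq_bigr => i _; rewrite mxE exprMn.
Qed.

Lemma enorm_delta_mx (R : realType) (k : nat) (i : 'I_k) :
  enorm (delta_mx ord0 i : 'rV[R]_k) = 1.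
Proof.
rewrite /enorm (bigD1 i)//= mxE !eqxx big1 ?addr0 ?expr1n ?sqrtr1//.
by move=> j ji; rewrite mxE (negbTE ji) andbF expr0n.
Qed.

Lemma le_pmulVe (R : realType) (s t : R) (L : \bar R) :
  0 < s -> ((s^-1 * t)%:E <= L)%E -> (t%:E <= s%:E * L)%E.
Proof.
move=> s0 h; have -> : t%:E = (s%:E * (s^-1 * t)%:E)%E.
  by rewrite -EFinM mulVKf// gt_eqF.
by rewrite lee_pmul2l// lte_fin.
Qed.

Lemma measurable_hat_coord0 (R : realType) (k : nat)
    (d : nat -> measure_display) (X : forall n, measurableType (d n))
    (hat : forall n, X n -> 'rV[R]_k) :
  estimator_sequence hat ->
  forall n i, measurable [set w | hat n w ord0 i = 0].
Proof.
move=> hhat n i; have /(_ measurableT) := hhat n.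
by move=> /(_ _ (measurable_coord_eq0 i)); rewrite setTI.
Qed.

Lemma measurable_hat_neq0 (R : realType) (k : nat)
    (d : nat -> measure_display) (X : forall n, measurableType (d n))
    (hat : forall n, X n -> 'rV[R]_k) :
  estimator_sequence hat -> forall n, measurable [set w | hat n w <> 0].
Proof.
move=> hhat n; rewrite neq0_bigsetU_coord; apply: bigsetU_measurable => i _.
exact/measurableC/measurable_hat_coord0.
Qed.

(** Sparsity speaks of one coordinate at a time; since [k] is fixed, summing the
    [k] error probabilities at the parameter [0], all of whose coordinates
    vanish, keeps the limit zero. *)
Lemma sparse_neq0_cvg0 (R : realType) (k : nat)
    (d : nat -> measure_display) (X : forall n, measurableType (d n))
    (P : forall n, 'rV[R]_k -> probability (X n) R)
    (hat : forall n, X n -> 'rV[R]_k) :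
  estimator_sequence hat -> sparse P hat ->
  (fun n => P n 0 [set w | hat n w <> 0]) @ \oo --> 0%E.
Proof.
move=> hhat hs.
pose Z n i := [set w | hat n w ord0 i = 0].
have mZ n i : measurable (Z n i) by exact: measurable_hat_coord0.
have coord i : (fun n => P n 0 (~` Z n i)) @ \oo --> 0%E.
  have -> : (fun n => P n 0 (~` Z n i)) = (fun n => (1 - P n 0%R (Z n i))%E).
    by apply/funext => n; rewrite probability_setC.
  rewrite -(@subee R 1%E)//; apply: cvgeB => //; first exact: cvg_cst.
  by apply: hs; rewrite mxE.
have sum0 : (fun n => (\sum_(i < k) P n 0%R (~` Z n i))%E) @ \oo --> 0%E.
  have {2}<- : (\sum_(i < k) 0 = 0 :> \bar R)%E by exact: big1.
  by apply: cvg_nnesum => // i _; near=> n; exact: measure_ge0.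
apply: (squeeze_cvge _ (cvg_cst _) sum0); apply: nearW => n.
rewrite measure_ge0/= neq0_bigsetU_coord; apply: measure_bigsetU_le => i.
exact/measurableC/mZ.
Unshelve. all: by end_near. Qed.

(** The infimum over parameters is at most, and the supremum at least, its value
    at [theta n], where contiguity makes [hat n w <> 0] negligible.  The events
    [A n] are abstract so that they can be read as large extent in a direction
    or as large diameter. *)
Lemma inf_coverage_le_sup_inner_probability (R : realType) (k : nat)
    (d : nat -> measure_display) (X : forall n, measurableType (d n))
    (P : forall n, 'rV[R]_k -> probability (X n) R)
    (hat : forall n, X n -> 'rV[R]_k)
    (C : forall n, X n -> set 'rV[R]_k)
    (theta : nat -> 'rV[R]_k) (A : forall n, set (X n)) :
  contiguous (fun n => P n (theta n)) (fun n => P n 0) ->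
  estimator_sequence hat -> sparse P hat -> (forall n, random_set (C n)) ->
  (forall n, based_on (P n) (C n) (hat n)) ->
  (forall n w, C n w 0 -> C n w (theta n) -> hat n w = 0 -> A n w) ->
  (asymptotic_infimal_coverage P C <= limn_einf (fun n =>
     ereal_sup [set inner_probability (P n theta) (A n)
               | theta in [set: 'rV[R]_k]]))%E.
Proof.
move=> hcontig hhat hsparse hC hbased hA.
have mN n : measurable [set w | hat n w <> 0] by exact: measurable_hat_neq0.
apply: (limn_einf_le_add_cvg0 (r := fun n => P n (theta n) [set w | hat n w <> 0])).
  move=> n; apply: (@le_trans _ _ (P n (theta n) [set w | C n w (theta n)])).
    by apply: ereal_inf_lbound; exists (theta n).
  have cov : (P n (theta n) [set w | C n w (theta n)] <=
      inner_probability (P n (theta n)) (A n) +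
      P n (theta n) [set w | hat n w <> 0%R])%E.
    apply: (le_inner_probability (hbased n (theta n)) (hC n (theta n)) (mN n)).
    by move=> w /= Ch Ct /contrapT h0; apply: hA => //; rewrite -h0.
  apply: (le_trans cov); rewrite leeD2r//.
  by apply: ereal_sup_ubound; exists (theta n).
exact: (hcontig _ mN (sparse_neq0_cvg0 hhat hsparse)).
Qed.

Theorem theorem2 (R : realType) (k : nat) (hk : (1 <= k)%N)
    (d : nat -> measure_display) (X : forall n, measurableType (d n))
    (P : forall n, 'rV[R]_k -> probability (X n) R)
    (hat : forall n, X n -> 'rV[R]_k)
    (C : forall n, X n -> set 'rV[R]_k)
    (delta : R)
    (hcontig : forall gamma : 'rV[R]_k,
       contiguous (fun n => P n ((Num.sqrt n.+1%:R)^-1 *: gamma))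
                  (fun n => P n 0))
    (hhat : estimator_sequence hat)
    (hsparse : sparse P hat)
    (hC : forall n, random_set (C n))
    (hbased : forall n, based_on (P n) (C n) (hat n))
    (hdelta : delta%:E = asymptotic_infimal_coverage P C) :
  (forall (t : R) (e : 'rV[R]_k), 0 <= t -> enorm e = 1 ->
     (delta%:E <= limn_einf (fun n =>
        ereal_sup [set inner_probability (P n theta)
                         [set w | t%:E <= (Num.sqrt n.+1%:R)%:E *
                                          ext (C n w) (hat n w) e]
                  | theta in [set: 'rV[R]_k]]))%E) /\
  (forall t : R, 0 <= t ->
     (delta%:E <= limn_einf (fun n =>
        ereal_sup [set inner_probability (P n theta)
                         [set w | t%:E <= (Num.sqrt n.+1%:R)%:E *
                                          diam (C n w)]
                  | theta in [set: 'rV[R]_k]]))%E).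
Proof.
have s0 n : 0 < Num.sqrt n.+1%:R :> R by rewrite sqrtr_gt0 ltr0n.
split=> [t e t0 e1|t t0]; rewrite hdelta.
  apply: (inf_coverage_le_sup_inner_probability (hcontig (t *: e))) => //.
  move=> n w _ Ct h0 /=.
  apply: le_pmulVe => //; apply: ereal_sup_ubound.
  exists ((Num.sqrt n.+1%:R)^-1 * t); split => //.
    by rewrite mulr_ge0// invr_ge0 ltW.
  by rewrite h0 addr0 -scalerA.
(* Any unit vector serves for the diameter. *)
pose e : 'rV[R]_k := delta_mx ord0 (Ordinal hk).
apply: (inf_coverage_le_sup_inner_probability (hcontig (t *: e))) => //.
move=> n w C0 Ct _ /=.
apply: le_pmulVe => //; apply: ereal_sup_ubound.
exists ((Num.sqrt n.+1%:R)^-1 *: (t *: e)), 0; split => //.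
rewrite subr0 !enormZ enorm_delta_mx mulr1 !ger0_norm// invr_ge0.
Qed.
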